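(* Let $\varepsilon\in(0,1)$ be fixed, let $\Delta_n>0$, $\mathcal R_n=[-\Delta_n,\Delta_n]$, and $$\mathcal N_n(\varepsilon)=\{\theta:|\theta|\le(1-\varepsilon)\Delta_n\},\qquad \mathcal M_n(\varepsilon)=\{\theta:|\theta|\ge(1+\varepsilon)\Delta_n\}.$$ Suppose an estimator $\hat\theta_n$ of the real parameter $\theta$ and a deterministic scale $s_n>0$, $s_n\downarrow0$, satisfy $$\lim_{M\to\infty}\limsup_{n\to\infty}\sup_{\theta\in\mathcal N_n(\varepsilon)\cup\mathcal M_n(\varepsilon)}P_\theta\bigl(|\hat\theta_n-\theta|>Ms_n\bigr)=0.$$ Let $\hat s_n$ be either $\hat s_n=s_n$, or a data-dependent positive scale such that $\hat s_n/s_n\to1$ uniformly in probability over $\mathcal N_n(\varepsilon)\cup\mathcal M_n(\varepsilon)$, that is, for every $\eta>0$, $\sup_{\theta\in\mathcal N_n(\varepsilon)\cup\mathcal M_n(\varepsilon)}P_\theta(|\hat s_n/s_n-1|>\eta)\to0$. If $$\frac{\Delta_n}{s_n}\to\infty,$$ then, for every fixed $0\le c<\infty$, the interval $C_n=[\hat\theta_n-c\hat s_n,\hat\theta_n+c\hat s_n]$ satisfies $$\inf_{\theta\in\mathcal N_n(\varepsilon)}P_\theta(C_n\subset\mathcal R_n)\to1\qquad\text{and}\qquad \inf_{\theta\in\mathcal M_n(\varepsilon)}P_\theta(C_n\cap\mathcal R_n=\emptyset)\to1.$$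
   Context: $P_\theta$ denotes the law of the data (at sample size $n$) under the real parameter value $\theta$; $\mathcal N_n(\varepsilon)$ and $\mathcal M_n(\varepsilon)$ are subsets of the model's parameter set (an infimum over an empty class is taken to be $1$ and a supremum over an empty class to be $0$). *)

(* Defs.v *)
From HB Require Import structures.
From mathcomp Require Export all_boot all_order all_algebra.
From mathcomp Require Export all_classical all_reals all_analysis.
Export numFieldNormedType.Exports.
Export Order.TTheory GRing.Theory Num.Theory.

Set Implicit Arguments.
Unset Strict Implicit.
Unset Printing Implicit Defensive.

Local Open Scope classical_set_scope.
Local Open Scope ring_scope.

(* Classes of parameter values inside the parameter set [Theta] of the
   experiment; they may be empty when [Theta] is a proper subset of R. *)
Definition near_class (R : realType) (Theta : set R) (eps Delta : R) : set R :=
  [set theta | Theta theta /\ `|theta| <= (1 - eps) * Delta].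

Definition far_class (R : realType) (Theta : set R) (eps Delta : R) : set R :=
  [set theta | Theta theta /\ `|theta| >= (1 + eps) * Delta].

(* The first argument of [supremum] and [infimum] is their value on the empty
   set: a supremum of probabilities over an empty class is 0, an infimum 1
   (whereas [ereal_sup] and [ereal_inf] would give -oo and +oo). *)
Definition sup_prob (R : realType) (d : measure_display) (T : measurableType d)
    (P : R -> probability T R) (K : set R) (E : R -> set T) : \bar R :=
  supremum 0%E [set P theta (E theta) | theta in K].

Definition inf_prob (R : realType) (d : measure_display) (T : measurableType d)
    (P : R -> probability T R) (K : set R) (E : R -> set T) : \bar R :=
  infimum 1%E [set P theta (E theta) | theta in K].

Definition sym_itv (R : realType) (center radius : R) : set R :=
  [set` `[center - radius, center + radius]].

Lemma sup_probE (R : realType) (d : measure_display) (T : measurableType d)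
    (P : R -> probability T R) (K : set R) (E : R -> set T) :
  K !=set0 ->
  sup_prob P K E = ereal_sup [set P theta (E theta) | theta in K].
Proof.
move=> [k Kk]; rewrite /sup_prob /ereal_sup /supremum ifF; last first.
  by apply/negbTE/set0P; exists (P k (E k)); exists k.
rewrite ifF; last by apply/negbTE/set0P; exists (P k (E k)); exists k.
case: xgetP => [y _ y_sup|no_sup].
  case: xgetP => [z _ z_sup|/(_ y)//].
  exact: (is_subset1_supremums y_sup z_sup).
by have [y /no_sup] := ereal_supremums_neq0 [set P theta (E theta) | theta in K].
Qed.

Lemma inf_probE (R : realType) (d : measure_display) (T : measurableType d)
    (P : R -> probability T R) (K : set R) (E : R -> set T) :
  K !=set0 ->
  inf_prob P K E = ereal_inf [set P theta (E theta) | theta in K].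
Proof.
move=> [k Kk]; rewrite /inf_prob /infimum ifF; last first.
  by apply/negbTE/set0P; exists (P k (E k)); exists k.
set A := [set _ | _ in K].
have infA : infimums A (ereal_inf A).
  by split=> [x Ax|x lbx]; [exact: ereal_inf_lbound | exact: le_ereal_inf_tmp].
case: xgetP => [y _ [lby uby]|/(_ _ infA)//].
by apply/eqP; rewrite eq_le; apply/andP; split; [exact: infA.2 | exact: (uby _ infA.1)].
Qed.

(* Main.v *)
(* Outside the events [|thetahat - theta| > B s] and [|shat / s - 1| > 1], the
   interval stays within distance [(B + 2 c) s] of [theta], while [theta] is at
   distance at least [eps Delta] from the boundary of [[-Delta, Delta]], which is
   eventually larger since [Delta / s] tends to infinity. The first event is
   uniformly small for large [B], the second one for large [n]. *)

Require Import Defs.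
From mathcomp Require Import lra measurable_realfun.

Set Implicit Arguments.
Unset Strict Implicit.
Unset Printing Implicit Defensive.

Local Open Scope classical_set_scope.
Local Open Scope ring_scope.

Lemma sup_prob_ge (R : realType) (d : measure_display) (T : measurableType d)
    (P : R -> probability T R) (K : set R) (E : R -> set T) (theta : R) :
  K theta -> (P theta (E theta) <= sup_prob P K E)%E.
Proof.
move=> Kt; rewrite sup_probE; last by exists theta.
by apply: ereal_sup_ubound; exists theta.
Qed.

(** Trades suprema for bounds at each [theta] with a threshold in [n] common to the whole class; an
    empty class then needs no separate case. *)
Lemma near_probability_le (R : realType) (d : nat -> measure_display)
    (T : forall n : nat, measurableType (d n))
    (P : forall n : nat, R -> probability (T n) R) (K : nat -> set R)
    (E : forall n, R -> set (T n)) (e : \bar R) :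
  (\forall n \near \oo, (sup_prob (P n) (K n) (E n) < e)%E) ->
  \forall n \near \oo, forall theta, K n theta ->
    (P n theta (E n theta) <= e)%E.
Proof.
apply: filterS => n /ltW supe theta Kt; apply: le_trans supe.
exact: sup_prob_ge.
Qed.

(** The condition [a <= 1] covers the empty class, whose infimum is 1. *)
Lemma inf_prob_ge (R : realType) (d : measure_display) (T : measurableType d)
    (P : R -> probability T R) (K : set R) (E : R -> set T) (a : \bar R) :
  (a <= 1)%E -> (forall theta, K theta -> (a <= P theta (E theta))%E) ->
  (a <= inf_prob P K E)%E.
Proof.
move=> a1 aE; have [->|/set0P K0] := eqVneq K set0.
  by rewrite /inf_prob image_set0 /infimum eqxx.
by rewrite inf_probE//; apply: le_ereal_inf_tmp => _ [theta /aE + <-].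
Qed.

Lemma inf_prob_le1 (R : realType) (d : measure_display) (T : measurableType d)
    (P : R -> probability T R) (K : set R) (E : R -> set T) :
  (forall theta, K theta -> measurable (E theta)) -> (inf_prob P K E <= 1)%E.
Proof.
move=> mE; have [->|/set0P[k Kk]] := eqVneq K set0.
  by rewrite /inf_prob image_set0 /infimum eqxx.
rewrite inf_probE; last by exists k.
apply: (@le_trans _ _ (P k (E k))); last by apply: probability_le1; exact: mE.
by apply: ereal_inf_lbound; exists k.
Qed.

(** The limsup is an infimum, over neighbourhoods of infinity, of suprema of [u]; one of these
    suprema is already below [a]. *)
Lemma limn_esup_lt_near (R : realType) (u : nat -> \bar R) (a : \bar R) :
  (limn_esup u < a)%E -> \forall n \near \oo, (u n < a)%E.
Proof.
move=> /ereal_inf_lt[_ [V oV <-] supa].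
apply: filterS oV => n Vn; apply: le_lt_trans supa.
by apply: ereal_sup_ubound; exists n.
Qed.

Lemma measurable_gt_fun (R : realType) (d : measure_display)
    (T : measurableType d) (f : T -> R) (a : R) :
  measurable_fun setT f -> measurable [set x | a < f x].
Proof.
move=> mf; rewrite (_ : [set _ | _] = setT `&` f @^-1` `]a, +oo[%classic).
  exact: mf.
by apply/seteqP; split=> x /=; rewrite in_itv/= andbT//; case.
Qed.

Lemma measurable_le_fun (R : realType) (d : measure_display)
    (T : measurableType d) (f : T -> R) (a : R) :
  measurable_fun setT f -> measurable [set x | f x <= a].
Proof.
move=> mf; rewrite (_ : [set _ | _] = ~` [set x | a < f x]).
  by apply: measurableC; exact: measurable_gt_fun.
by apply/seteqP; split=> x /=; rewrite leNgt => /negP.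
Qed.

(** Union bound shared by both limits: [A B] stands for a deviation of the estimator beyond [B]
    scales, [S] for a deviation of the scale, and [G] for the desired event. Each bad event receives
    half of the error. *)
Lemma inf_prob_cvg1 (R : realType) (d : nat -> measure_display)
    (T : forall n : nat, measurableType (d n))
    (P : forall n : nat, R -> probability (T n) R) (K : nat -> set R)
    (A : R -> forall n, R -> set (T n)) (S G : forall n, set (T n)) :
  (forall B n theta, measurable (A B n theta)) ->
  (forall n, measurable (S n)) -> (forall n, measurable (G n)) ->
  (forall e, 0 < e -> exists B, \forall n \near \oo,
     forall theta, K n theta -> (P n theta (A B n theta) <= e%:E)%E) ->
  (forall e, 0 < e -> \forall n \near \oo,
     forall theta, K n theta -> (P n theta (S n) <= e%:E)%E) ->
  (forall B, \forall n \near \oo,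
     forall theta, K n theta -> ~` G n `<=` A B n theta `|` S n) ->
  inf_prob (P n) (K n) (fun=> G n) @[n --> \oo] --> 1%E.
Proof.
move=> mA mS mG Asmall Ssmall cover.
have le1 n : (inf_prob (P n) (K n) (fun=> G n) <= 1)%E.
  exact: inf_prob_le1.
have ge0 n : (0 <= inf_prob (P n) (K n) (fun=> G n))%E.
  by apply: inf_prob_ge.
have fin n : inf_prob (P n) (K n) (fun=> G n) \is a fin_num.
  by rewrite ge0_fin_numE//; apply: le_lt_trans (le1 n) _; rewrite ltry.
apply/fine_cvgP; split; first exact: nearW.
apply/cvgrPdist_le => e e0.
have e20 : 0 < e / 2 by rewrite divr_gt0.
(* [B] depends on [e] only and is fixed before [n], so [cover] may be used at this [B] for large
   [n]. *)
have [B Bsmall] := Asmall _ e20.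
near=> n.
rewrite /= ger0_norm; last by rewrite subr_ge0 -lee_fin fineK.
rewrite lerBlDl -lerBlDr -lee_fin fineK//.
apply: inf_prob_ge => [|theta Kt]; first by rewrite lee_fin gerBl ltW.
have PA : (P n theta (A B n theta) <= (e / 2)%:E)%E.
  (* Generalizing [theta] first keeps the threshold in [n] uniform over the class; likewise
     below. *)
  by move: theta Kt; near: n.
have PS : (P n theta (S n) <= (e / 2)%:E)%E.
  by move: theta Kt {PA}; near: n; exact: Ssmall.
have sub : ~` G n `<=` A B n theta `|` S n.
  by move: theta Kt {PA PS}; near: n; exact: cover.
rewrite -[G n]setCK probability_setC; last exact: measurableC.
rewrite EFinB leeB// [e in e%:E]splitr EFinD.
apply: le_trans (leeD PA PS).
apply: le_trans (measureU2 _ (mA _ _ _) (mS _)).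
by apply: le_measure; rewrite ?inE//; [exact: measurableC|exact: measurableU].
Unshelve. all: by end_near. Qed.

(* Without [0 <= r] the interval is empty and the left-to-right implication
   fails; the same holds for [sym_itv_disjoint]. *)
Lemma sym_itv_subset (R : realType) (a r D : R) : 0 <= r ->
  (sym_itv a r `<=` [set` `[- D, D]]) <-> `|a| + r <= D.
Proof.
move=> r0; split=> [sub|aD x /=].
  have := sub (a - r); rewrite /sym_itv/= !in_itv/= => /(_ ltac:(lra)) H1.
  have := sub (a + r); rewrite /sym_itv/= !in_itv/= => /(_ ltac:(lra)) H2.
  by rewrite -lerBrDr ler_norml; lra.
move: aD; rewrite -lerBrDr ler_norml /sym_itv/= !in_itv/= => aD; lra.
Qed.

Lemma sym_itv_disjoint (R : realType) (a r D : R) : 0 <= r -> 0 <= D ->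
  (sym_itv a r `&` [set` `[- D, D]] = set0) <-> D < `|a| - r.
Proof.
move=> r0 D0; split=> [dis|].
  rewrite ltNge; apply/negP => aD.
  (* The point of the interval closest to 0: it lies in [[-D, D]] as soon as any point of the
     interval does. *)
  pose y := if 0 <= a then Num.max 0 (a - r) else Num.min 0 (a + r).
  suff : (sym_itv a r `&` [set` `[- D, D]]) y by rewrite dis.
  rewrite /sym_itv/= !in_itv/= /y; case: ifPn => a0.
    by move: aD; rewrite ger0_norm//; case: (lerP 0 (a - r)) => *; split; lra.
  move: a0 aD; rewrite -ltNge => a0; rewrite ltr0_norm//.
  by case: (lerP 0 (a + r)) => *; split; lra.
move=> Da; rewrite -subset0 => y []; rewrite /sym_itv/= !in_itv/=.
by move: Da; case: (ger0P a) => *; lra.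
Qed.

Theorem proposition3 (R : realType)
    (d : nat -> measure_display) (T : forall n : nat, measurableType (d n))
    (Theta : nat -> set R) (P : forall n : nat, R -> probability (T n) R)
    (eps : R) (Delta s : nat -> R)
    (thetahat shat : forall n : nat, {mfun T n >-> R}) :
  let N n := near_class (Theta n) eps (Delta n) in
  let M n := far_class (Theta n) eps (Delta n) in
  let Rn n := [set` `[- Delta n, Delta n]] in
  0 < eps < 1 ->
  (forall n, 0 < Delta n) ->
  (forall n, 0 < s n) ->
  nonincreasing_seq s ->
  s n @[n --> \oo] --> 0 ->
  limn_esup (fun n => sup_prob (P n) (N n `|` M n)
    (fun theta => [set x | `|thetahat n x - theta| > B * s n]))
    @[B --> +oo] --> 0%E ->
  (forall n x, shat n x = s n) \/
  ((forall n x, 0 < shat n x) /\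
   (forall eta : R, 0 < eta ->
      sup_prob (P n) (N n `|` M n)
        (fun=> [set x | `|shat n x / s n - 1| > eta])
        @[n --> \oo] --> 0%E)) ->
  Delta n / s n @[n --> \oo] --> +oo ->
  forall c : R, 0 <= c ->
  let C n x := sym_itv (thetahat n x) (c * shat n x) in
  inf_prob (P n) (N n) (fun=> [set x | C n x `<=` Rn n]) @[n --> \oo] --> 1%E /\
  inf_prob (P n) (M n) (fun=> [set x | C n x `&` Rn n = set0])
    @[n --> \oo] --> 1%E.
Proof.
move=> N M Rn /andP[e0 e1] D0 s0 _ _ thetaC shatC Ds c c0 C.
have shat0 n x : 0 < shat n x.
  by case: shatC => [->|[+ _]]; [exact: s0|exact].
have Asmall e : 0 < e -> exists B, \forall n \near \oo,
    forall theta, (N n `|` M n) theta ->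
    (P n theta [set x | (`|thetahat n x - theta| > B * s n)%R] <= e%:E)%E.
  move=> e_gt0.
  have /thetaC [B0 [_ HB]] : nbhs 0%E [set y : \bar R | (y < e%:E)%E].
    by apply: open_ereal_lt'; rewrite lte_fin.
  (* The limit in [B] controls only the values strictly above [B0]. *)
  exists (B0 + 1).
  apply: (near_probability_le
    (E := fun n theta => [set x | `|thetahat n x - theta| > (B0 + 1) * s n])).
  by apply: limn_esup_lt_near; apply: HB; rewrite ltrDl.
(* Tolerance 1 gives [shat <= 2 s] off this event, whence the factor 2 in [shat2] and [margin]. If
   [shat] equals [s], the event is empty. *)
have Ssmall e : 0 < e -> \forall n \near \oo,
    forall theta, (N n `|` M n) theta ->
    (P n theta [set x | (`|shat n x / s n - 1| > 1)%R] <= e%:E)%E.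
  move=> e_gt0; case: shatC => [shatE|[_ /(_ _ ltr01) shatC]].
    apply: nearW => n theta _; rewrite (_ : [set _ | _] = set0).
      by rewrite measure0 lee_fin ltW.
    rewrite -subset0 => x /=.
    by rewrite shatE divff ?gt_eqF// subrr normr0 ltr10.
  apply: (near_probability_le
    (E := fun n => fun=> [set x | `|shat n x / s n - 1| > 1])).
  by apply: (shatC [set y | (y < e%:E)%E]); apply: open_ereal_lt'; rewrite lte_fin.
have mA B n theta : measurable [set x | `|thetahat n x - theta| > B * s n].
  apply: measurable_gt_fun; apply: measurableT_comp => //.
  exact: measurable_funB.
have mS n : measurable [set x | `|shat n x / s n - 1| > 1].
  apply: measurable_gt_fun; apply: measurableT_comp => //.
  by apply: measurable_funB => //; exact: measurable_funM.
have shat2 n x : ~ (`|shat n x / s n - 1| > 1) -> c * shat n x <= c * 2 * s n.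
  move=> /negP; rewrite -leNgt ler_norml => /andP[_ h].
  by rewrite -mulrA ler_wpM2l// -ler_pdivrMr//; lra.
have margin B : \forall n \near \oo, (B + c * 2) * s n < eps * Delta n.
  have /cvgryPgt/(_ ((B + c * 2) / eps)) := Ds.
  apply: filterS => n; rewrite ltr_pdivrMr// mulrAC ltr_pdivlMr//.
  by rewrite [Delta n * _]mulrC.
have cs0 n x : 0 <= c * shat n x by rewrite mulr_ge0// ltW.
split.
(* This form of the event gives both its measurability and the inequality to be proved. *)
- have E n : [set x | C n x `<=` Rn n] =
             [set x | `|thetahat n x| + c * shat n x <= Delta n].
    by apply/seteqP; split=> x /sym_itv_subset; exact.
  apply: (inf_prob_cvg1 mA mS).
  + move=> n; rewrite E; apply: measurable_le_fun; apply: measurable_funD.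
      exact: measurableT_comp.
    exact: measurable_funM.
  + move=> e /Asmall[B HB]; exists B; apply: filterS HB => n + theta Nt.
    by apply; left.
  + move=> e /Ssmall; apply: filterS => n + theta Nt; apply; left; exact: Nt.
  + move=> B; have := margin B; apply: filterS => n mn theta [_ Nt] x.
    rewrite E /= => nG; apply: contrapT => /not_orP[/negP + /shat2].
    rewrite -leNgt => At Sx; apply: nG.
    (* Hence [|thetahat| + c shat <= (1 - eps) Delta + (B + 2 c) s], which [margin] puts below
       [Delta]. *)
    have := ler_normD (thetahat n x - theta) theta; rewrite subrK => tri.
    move: mn Nt; rewrite mulrDl mulrBl mul1r; lra.
- have E n : [set x | C n x `&` Rn n = set0] =
             [set x | Delta n < `|thetahat n x| - c * shat n x].
    by apply/seteqP; split=> x /sym_itv_disjoint; apply=> //; exact: ltW.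
  apply: (inf_prob_cvg1 mA mS).
  + move=> n; rewrite E; apply: measurable_gt_fun; apply: measurable_funB.
      exact: measurableT_comp.
    exact: measurable_funM.
  + move=> e /Asmall[B HB]; exists B; apply: filterS HB => n + theta Nt.
    by apply; right.
  + move=> e /Ssmall; apply: filterS => n + theta Nt; apply; right; exact: Nt.
  + move=> B; have := margin B; apply: filterS => n mn theta [_ Mt] x.
    rewrite E /= => nG; apply: contrapT => /not_orP[/negP + /shat2].
    rewrite -leNgt => At Sx; apply: nG.
    (* Here [|thetahat| - c shat >= (1 + eps) Delta - (B + 2 c) s]; the strict inequality in
       [margin] yields the strict one that disjointness requires. *)
    have := ler_normD (theta - thetahat n x) (thetahat n x).
    rewrite subrK distrC => tri.
    move: mn Mt; rewrite mulrDl mulrDl mul1r; lra.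
Qed.
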